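(* Let $R$ be a tolerance on a set $U$ induced by an irredundant covering $\mathcal{H}$ of $U$. Then $\mathcal{H}\subseteq\mathcal{B}(R)$.
   Context: A tolerance on $U$ is a reflexive and symmetric binary relation on $U$. A covering of $U$ is a collection $\mathcal{H}$ of nonempty subsets of $U$ with $\bigcup\mathcal{H}=U$; it is irredundant if $\mathcal{H}\setminus\{X\}$ is not a covering of $U$ for any $X\in\mathcal{H}$. The tolerance induced by a covering $\mathcal{H}$ is $R_{\mathcal{H}}=\bigcup\{X^2\mid X\in\mathcal{H}\}$, where $X^2=X\times X$. A nonempty $X\subseteq U$ is an $R$-preblock if $X^2\subseteq R$; an $R$-block is an $R$-preblock maximal with respect to inclusion; $\mathcal{B}(R)$ is the set of all $R$-blocks. *)

(* Defs.v *)
From mathcomp Require Import all_boot.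
From mathcomp Require Import boolp classical_sets.

Set Implicit Arguments.
Unset Strict Implicit.
Unset Printing Implicit Defensive.

Local Open Scope classical_set_scope.

(* The ground set is a type [U], possibly empty or infinite; a binary relation
   on [U] is a set of pairs. *)

Definition tolerance (U : Type) (R : set (U * U)) : Prop :=
  (forall x, R (x, x)) /\ (forall x y, R (x, y) -> R (y, x)).

Definition covering (U : Type) (H : set (set U)) : Prop :=
  (forall X, H X -> X !=set0) /\ \bigcup_(X in H) X = [set: U].

Definition irredundant_covering (U : Type) (H : set (set U)) : Prop :=
  covering H /\ forall X, H X -> ~ covering (H `\ X).

Definition induced_tolerance (U : Type) (H : set (set U)) : set (U * U) :=
  \bigcup_(X in H) (X `*` X).

Definition preblock (U : Type) (R : set (U * U)) (X : set U) : Prop :=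
  X !=set0 /\ X `*` X `<=` R.

Definition blocks (U : Type) (R : set (U * U)) : set (set U) :=
  [set X | preblock R X /\ forall Y, preblock R Y -> X `<=` Y -> Y = X].

(* Main.v *)
Require Import Defs.
From mathcomp Require Import all_boot.
From mathcomp Require Import boolp classical_sets.

Local Open Scope classical_set_scope.

(** Irredundancy gives each member [X] of the covering a private point, lying
    in no other member ([irredundant_private_point]). A private point [a] of
    [X] is related only to points of [X], because a pair in the induced
    tolerance lies in a common member, and the only member through [a] is [X].
    A preblock containing [X] contains [a], so it consists of points related
    to [a] and cannot extend beyond [X]. *)

(** If every point of [X] also lay in another member, then [X] could be removed
    and the remaining sets would still cover. *)
Lemma irredundant_private_point (U : Type) (H : set (set U)) (X : set U) :
  irredundant_covering H -> H X ->
  exists2 a, X a & forall Z, H Z -> Z a -> Z = X.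
Proof.
move=> [[H_neq0 H_cover] H_irr] HX; apply: contrapT => no_private.
apply: (H_irr X HX); split => [Z [HZ _]|]; first exact: H_neq0.
apply/seteqP; split => // u _; apply: contrapT => u_uncovered.
have only_X Z : H Z -> Z u -> Z = X.
  by move=> HZ Zu; apply: contrapT => ZX; apply: u_uncovered; exists Z.
have [Z HZ Zu] : (\bigcup_(Z in H) Z) u by rewrite H_cover.
by apply: no_private; exists u => //; rewrite -(only_X Z HZ Zu).
Qed.

Theorem lemma2p3 (U : Type) (R : set (U * U)) (H : set (set U))
    (R_tolerance : tolerance R)
    (H_irredundant : irredundant_covering H)
    (R_induced : R = induced_tolerance H) :
  H `<=` blocks R.
Proof.
move=> X HX; rewrite R_induced; split.
  split; first by case: H_irredundant => -[H_neq0 _] _; exact: H_neq0.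
  by move=> p Xp; exists X.
move=> Y [_ YY] XY; apply/seteqP; split => // y Yy.
have [a Xa a_private] := irredundant_private_point _ _ _ H_irredundant HX.
have [Z HZ [/= Za Zy]] := YY (a, y) (conj (XY a Xa) Yy).
by rewrite -(a_private Z HZ Za).
Qed.
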